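(* Let $n\ge2$ and let $r_1\ge\cdots\ge r_n\ge0$ with $R_0:=\sum_{i=1}^n r_i>0$. Consider the booby trap search game with $n$ boxes, rewards $r_1,\dots,r_n$ and $k=1$ booby trap on the complete hypergraph on $[n]$. Let $S^*\subseteq[n]$ be a subset that minimizes $|r(S)-r(\bar S)|$ over all $S\subseteq[n]$, where $\bar S=[n]\setminus S$ is the complement of $S$. Then it is optimal for the Searcher to choose $S^*$ with probability $$p(S^* )=\frac{r(\bar S^* )}{R_0}$$ and otherwise to choose $\bar S^*$. It is optimal for the Hider to put the booby trap in box $i$ with probability $q_i=r_i/R_0$ for $i\in[n]$. The value $V$ of the game is $$V=\frac{r(S^* )\,r(\bar S^* )}{R_0}.$$
   Context: The booby trap search game: there are $n$ boxes, identified with the vertex set $[n]=\{1,\dots,n\}$ of a hypergraph $G$ with set of hyperedges $E\subseteq 2^{[n]}$. Box $i$ contains a reward $r_i$. A Hider pure strategy is a set $H\in[n]^{(k)}=\{H\subseteq[n]:|H|=k\}$ (the booby trapped boxes). A Searcher pure strategy is a hyperedge $S\in E$ (the boxes opened). For $S\subseteq[n]$ write $r(S)=\sum_{i\in S}r_i$. The payoff (to the maximizing Searcher, in a zero-sum game against the minimizing Hider) is $R(S,H)=r(S)$ if $S\cap H=\emptyset$, and $R(S,H)=0$ otherwise. Mixed strategies are probability distributions over pure strategies, and payoffs extend by expectation. Value and optimal strategies are in the usual sense for finite two-person zero-sum games. In the complete hypergraph, $E=2^{[n]}$, so the Searcher may open any subset of $[n]$. *)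

(* Defs.v *)
From HB Require Import structures.
From mathcomp Require Import all_boot all_order all_algebra.
From mathcomp Require Import classical_sets reals.

Set Implicit Arguments.
Unset Strict Implicit.
Unset Printing Implicit Defensive.

Import Order.TTheory GRing.Theory Num.Theory.

Local Open Scope ring_scope.

Section ZeroSumGame.
Variables (R : realType) (T U : finType).
(* Pure strategies: [A] for the maximizer, [B] for the minimizer; [u] is the
   payoff to the maximizer. *)
Variables (A : {set T}) (B : {set U}) (u : T -> U -> R).

Definition mixed (X : finType) (D : {set X}) (p : {ffun X -> R}) : Prop :=
  [/\ forall x, 0 <= p x,
      forall x, x \notin D -> p x = 0
    & \sum_(x in D) p x = 1].

Definition expected_payoff (p : {ffun T -> R}) (q : {ffun U -> R}) : R :=
  \sum_(a in A) \sum_(b in B) p a * q b * u a b.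

(* For nonempty [A] and [B] all the sets below are nonempty and bounded, so
   [sup] and [inf] are genuine suprema and infima. *)
Definition maximin : R :=
  sup [set inf [set expected_payoff p q | q in [set q | mixed B q]]
      | p in [set p | mixed A p]]%classic.

Definition minimax : R :=
  inf [set sup [set expected_payoff p q | p in [set p | mixed A p]]
      | q in [set q | mixed B q]]%classic.

Definition is_game_value (v : R) : Prop := maximin = v /\ minimax = v.

Definition optimal_maximizer (p : {ffun T -> R}) : Prop :=
  mixed A p /\ forall q, mixed B q -> maximin <= expected_payoff p q.

Definition optimal_minimizer (q : {ffun U -> R}) : Prop :=
  mixed B q /\ forall p, mixed A p -> expected_payoff p q <= minimax.

End ZeroSumGame.

Section BoobyTrap.
Variables (R : realType) (n : nat) (r : 'I_n -> R).

Definition reward (S : {set 'I_n}) : R := \sum_(i in S) r i.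

Definition booby_payoff (S H : {set 'I_n}) : R :=
  if [disjoint S & H] then reward S else 0.

Definition hider_pure (k : nat) : {set {set 'I_n}} :=
  [set H : {set 'I_n} | #|H| == k].

(* The game on the hypergraph with hyperedge set [E] and [k] booby traps. *)
Definition booby_value (E : {set {set 'I_n}}) (k : nat) (v : R) : Prop :=
  is_game_value E (hider_pure k) booby_payoff v.

Definition searcher_optimal (E : {set {set 'I_n}}) (k : nat)
    (p : {ffun {set 'I_n} -> R}) : Prop :=
  optimal_maximizer E (hider_pure k) booby_payoff p.

Definition hider_optimal (E : {set {set 'I_n}}) (k : nat)
    (q : {ffun {set 'I_n} -> R}) : Prop :=
  optimal_minimizer E (hider_pure k) booby_payoff q.

End BoobyTrap.

Definition complete_hypergraph (n : nat) : {set {set 'I_n}} :=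
  [set: {set 'I_n}].

(* Probability [t] on [S] and [1 - t] on its complement. *)
Definition choose_or_complement (R : realType) (n : nat) (S : {set 'I_n})
    (t : R) : {ffun {set 'I_n} -> R} :=
  [ffun S' => t * (S' == S)%:R + (1 - t) * (S' == ~: S)%:R].

(* A distribution on the boxes, viewed as one on the sets of boxes through
   [i |-> [set i]]. *)
Definition trap_in_box (R : realType) (n : nat) (q : 'I_n -> R) :
    {ffun {set 'I_n} -> R} :=
  [ffun H => \sum_(i < n | H == [set i]) q i].

(* Main.v *)
(** Splitting the mass between [S] and its complement, in inverse proportion to
    their rewards, makes the Searcher's payoff equal to [r(S) r(~S) / R0]
    wherever the trap lies.  A trap placed with probabilities [r i / R0] makes
    the payoff of any [S] equal to [r(S) r(~S) / R0] as well.  Since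
    [4 r(S) r(~S) = R0^2 - (r(S) - r(~S))^2], the most balanced [S] maximizes
    this quantity, so the two strategies form a saddle point. *)

Require Import Defs.
From HB Require Import structures.
From mathcomp Require Import all_boot all_order all_algebra.
From mathcomp Require Import classical_sets reals.
From mathcomp Require Import ring lra.

Set Implicit Arguments.
Unset Strict Implicit.
Unset Printing Implicit Defensive.

Import Order.TTheory GRing.Theory Num.Theory.

Local Open Scope ring_scope.

Section SaddlePoint.
Variables (R : realType) (T U : finType).
Variables (A : {set T}) (B : {set U}) (u : T -> U -> R).

Lemma mixed_le1 (X : finType) (D : {set X}) (p : {ffun X -> R}) x :
  mixed D p -> p x <= 1.
Proof.
case=> p_ge0 p_out p_sum; have [xD|/p_out->//] := boolP (x \in D).
by rewrite -p_sum (bigD1 x) //= lerDl sumr_ge0.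
Qed.

(** Probabilities are at most 1, so the triangle inequality applies termwise. The bound is
    independent of [p] and [q], which makes the [sup] and [inf] in [maximin] and [minimax]
    genuine. *)
Lemma expected_payoff_bounded p q : mixed A p -> mixed B q ->
  `|expected_payoff A B u p q| <= \sum_(a in A) \sum_(b in B) `|u a b|.
Proof.
move=> Ap Bq; have [p_ge0 _ _] := Ap; have [q_ge0 _ _] := Bq.
apply: le_trans (ler_norm_sum _ _ _) _; apply: ler_sum => a _.
apply: le_trans (ler_norm_sum _ _ _) _; apply: ler_sum => b _.
rewrite !normrM (ger0_norm (p_ge0 a)) (ger0_norm (q_ge0 b)).
by rewrite ler_piMl ?normr_ge0 // mulr_ile1 ?(mixed_le1 _ Ap) ?(mixed_le1 _ Bq).
Qed.

(** The payoff against [q] is a [q]-average of payoffs against pure strategies, so a guarantee need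
    only be checked on the latter. *)
Lemma expected_payoff_maximizer_pure (p : {ffun T -> R}) (q : {ffun U -> R})
    (v : R) :
  mixed B q ->
  (forall b, b \in B -> v <= \sum_(a in A) p a * u a b) ->
  v <= expected_payoff A B u p q.
Proof.
case=> q_ge0 _ q_sum le_v; rewrite /expected_payoff exchange_big /=.
rewrite -[v]mul1r -q_sum mulr_suml; apply: ler_sum => b Bb.
under eq_bigr do rewrite mulrAC mulrC.
by rewrite -mulr_sumr ler_wpM2l // le_v.
Qed.

Lemma expected_payoff_minimizer_pure (p : {ffun T -> R}) (q : {ffun U -> R})
    (v : R) :
  mixed A p ->
  (forall a, a \in A -> \sum_(b in B) q b * u a b <= v) ->
  expected_payoff A B u p q <= v.
Proof.
case=> p_ge0 _ p_sum ge_v; rewrite /expected_payoff.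
rewrite -[v]mul1r -p_sum mulr_suml; apply: ler_sum => a Aa.
under eq_bigr do rewrite -mulrA.
by rewrite -mulr_sumr ler_wpM2l // ge_v.
Qed.

Variables (p0 : {ffun T -> R}) (q0 : {ffun U -> R}) (v : R).
Hypotheses (Ap0 : mixed A p0) (Bq0 : mixed B q0).
Hypothesis p0_ge : forall q, mixed B q -> v <= expected_payoff A B u p0 q.
Hypothesis q0_le : forall p, mixed A p -> expected_payoff A B u p q0 <= v.

(** Replying with [q0] keeps every inner infimum at most [v], and the inner infimum at [p0] is at
    least [v]. *)
Lemma saddle_point_maximin : maximin A B u = v.
Proof.
rewrite /maximin; set I := (X in sup X).
have I_le : ubound I v.
  move=> _ [p Ap <-]; apply: le_trans (q0_le Ap).
  apply: ge_inf; last by exists q0.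
  exists (- \sum_(a in A) \sum_(b in B) `|u a b|) => _ [q Bq <-].
  by have := expected_payoff_bounded Ap Bq; rewrite ler_norml => /andP[].
apply/eqP; rewrite eq_le; apply/andP; split.
  by apply: ge_sup => //; eexists; exists p0.
apply: (@le_trans _ _ (inf [set expected_payoff A B u p0 q
                           | q in [set q | mixed B q]]%classic)).
  by apply: lb_le_inf; [eexists; exists q0 | move=> _ [q Bq <-]; exact: p0_ge].
by apply: ub_le_sup; [exists v | exists p0].
Qed.

Lemma saddle_point_minimax : minimax A B u = v.
Proof.
rewrite /minimax; set I := (X in inf X).
have I_ge : lbound I v.
  move=> _ [q Bq <-]; apply: le_trans (p0_ge Bq) _.
  apply: ub_le_sup; last by exists p0.
  exists (\sum_(a in A) \sum_(b in B) `|u a b|) => _ [p Ap <-].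
  by have := expected_payoff_bounded Ap Bq; rewrite ler_norml => /andP[].
apply/eqP; rewrite eq_le; apply/andP; split; last first.
  by apply: lb_le_inf => //; eexists; exists q0.
apply: (@le_trans _ _ (sup [set expected_payoff A B u p q0
                           | p in [set p | mixed A p]]%classic)).
  by apply: ge_inf; [exists v | exists q0].
by apply: ge_sup; [eexists; exists p0 | move=> _ [p Ap <-]; exact: q0_le].
Qed.

Lemma saddle_point :
  [/\ optimal_maximizer A B u p0, optimal_minimizer A B u q0
    & is_game_value A B u v].
Proof.
rewrite /optimal_maximizer /optimal_minimizer /is_game_value.
by rewrite saddle_point_maximin saddle_point_minimax.
Qed.

End SaddlePoint.

Section Strategies.
Variables (R : realType) (n : nat).

(** Kept general in [f]: the constant 1 gives the total mass, the payoff against a fixed trap gives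
    the Searcher's expectation. *)
Lemma sum_choose_or_complement (S : {set 'I_n}) (t : R) (f : {set 'I_n} -> R) :
  \sum_(S' in complete_hypergraph n) choose_or_complement S t S' * f S'
    = t * f S + (1 - t) * f (~: S).
Proof.
have sum_delta X c : \sum_(S' in complete_hypergraph n) c * (S' == X)%:R * f S'
                       = c * f X.
  rewrite (bigD1 X) ?inE //= eqxx mulr1 big1 ?addr0 // => S' /andP[_ /negPf->].
  by rewrite mulr0 mul0r.
under eq_bigr do rewrite ffunE mulrDl.
by rewrite big_split /= !sum_delta.
Qed.

Lemma sum_trap_in_box (q : 'I_n -> R) (f : {set 'I_n} -> R) :
  \sum_(H in hider_pure n 1) trap_in_box q H * f H
    = \sum_(i < n) q i * f [set i].
Proof.
under eq_bigr do rewrite ffunE mulr_suml.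
(* For a fixed box [i], only [H = [set i]] contributes, and it does have size 1. *)
rewrite (exchange_big_dep predT) //=; apply: eq_bigr => i _.
apply: big_pred1 => H /=; rewrite inE.
by case: (H =P [set i]) => [->|_]; rewrite ?cards1 ?andbF.
Qed.

Lemma mixed_choose_or_complement (S : {set 'I_n}) (t : R) : 0 <= t <= 1 ->
  mixed (complete_hypergraph n) (choose_or_complement S t).
Proof.
move=> /andP[t_ge0 t_le1]; split=> [S'|S'|]; last 1 first.
- have := sum_choose_or_complement S t (fun=> 1).
  by under eq_bigr do rewrite mulr1; rewrite !mulr1 addrC subrK.
- by rewrite ffunE addr_ge0 // mulr_ge0 ?ler0n // subr_ge0.
- by rewrite inE.
Qed.

Lemma mixed_trap_in_box (q : 'I_n -> R) :
  (forall i, 0 <= q i) -> \sum_(i < n) q i = 1 ->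
  mixed (hider_pure n 1) (trap_in_box q).
Proof.
move=> q_ge0 q_sum; split=> [H|H|].
- by rewrite ffunE sumr_ge0.
- rewrite inE ffunE => H1; rewrite big1 // => i /eqP defH.
  by rewrite defH cards1 in H1.
- have := sum_trap_in_box q (fun=> 1).
  by under eq_bigr do rewrite mulr1; under [in RHS]eq_bigr do rewrite mulr1;
    rewrite q_sum.
Qed.

Variable r : 'I_n -> R.

Lemma rewardC (S : {set 'I_n}) :
  reward r S + reward r (~: S) = \sum_(i < n) r i.
Proof.
rewrite /reward [RHS](bigID (mem S)) /=; congr (_ + _).
by apply: eq_bigl => i; rewrite inE.
Qed.

Lemma booby_payoff1 (S : {set 'I_n}) i :
  booby_payoff r S [set i] = if i \in S then 0 else reward r S.
Proof. by rewrite /booby_payoff disjoint_sym disjoints1 if_neg. Qed.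

(** Exactly one of [S] and [~: S] avoids box [i]. Each is chosen with probability proportional to
    the reward of the other, so probability times reward is the same in both cases. *)
Lemma choose_or_complement_payoff (S : {set 'I_n}) i :
  \sum_(j < n) r j != 0 ->
  \sum_(S' in complete_hypergraph n)
     choose_or_complement S (reward r (~: S) / \sum_(j < n) r j) S'
       * booby_payoff r S' [set i]
    = reward r S * reward r (~: S) / \sum_(j < n) r j.
Proof.
rewrite sum_choose_or_complement !booby_payoff1 inE -(rewardC S) => R0_neq0.
by case: (i \in S) => /=; field.
Qed.

(** [S] earns its reward exactly when the trap lies in [~: S], which carries weight
    [reward r (~: S) / R0]. *)
Lemma trap_in_box_payoff (S : {set 'I_n}) (R0 : R) :
  \sum_(H in hider_pure n 1)
     trap_in_box (fun i => r i / R0) H * booby_payoff r S H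
    = reward r S * reward r (~: S) / R0.
Proof.
rewrite sum_trap_in_box (bigID (mem S)) /= big1 ?add0r => [|i Si]; last first.
  by rewrite booby_payoff1 Si mulr0.
(* Expand [reward r (~: S)] on the right, to compare both sides box by box outside [S]. *)
rewrite mulrAC [RHS]mulrC mulrA -mulrA [X in _ = X]mulr_suml.
by apply: eq_big => [i|i nSi]; rewrite ?inE // booby_payoff1 (negPf nSi); ring.
Qed.

Lemma reward_prod_le (S S0 : {set 'I_n}) :
  `|reward r S0 - reward r (~: S0)| <= `|reward r S - reward r (~: S)| ->
  reward r S * reward r (~: S) <= reward r S0 * reward r (~: S0).
Proof.
have := rewardC S; rewrite -(rewardC S0) => sumE.
rewrite -ler_sqr ?nnegrE ?normr_ge0 // !real_normK ?num_real //.
(* With the totals squared too, the claim is linear in the squares and products of the four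
   rewards. *)
have := congr1 (fun x => x ^+ 2) sumE; rewrite /=; lra.
Qed.

End Strategies.

Theorem theorem5 (R : realType) (n : nat) (hn : (2 <= n)%N)
    (r : 'I_n -> R)
    (r_decr : forall i j : 'I_n, (i <= j)%N -> r j <= r i)
    (r_ge0 : forall i : 'I_n, 0 <= r i)
    (R0 : R) (hR0 : R0 = \sum_(i < n) r i) (R0_gt0 : 0 < R0)
    (Sstar : {set 'I_n})
    (Sstar_min : forall S : {set 'I_n},
       `|reward r Sstar - reward r (~: Sstar)|
         <= `|reward r S - reward r (~: S)|) :
  [/\ searcher_optimal r (complete_hypergraph n) 1
        (choose_or_complement Sstar (reward r (~: Sstar) / R0)),
      hider_optimal r (complete_hypergraph n) 1
        (trap_in_box (fun i : 'I_n => r i / R0))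
    & booby_value r (complete_hypergraph n) 1
        (reward r Sstar * reward r (~: Sstar) / R0)].
Proof.
have R0_neq0 : R0 != 0 by rewrite gt_eqF.
have reward_ge0 S : 0 <= reward r S by apply: sumr_ge0.
apply: saddle_point.
- apply: mixed_choose_or_complement; rewrite divr_ge0 ?(ltW R0_gt0) //=.
  (* The probability is at most 1 because [R0] exceeds [reward r (~: Sstar)] by the nonnegative
     [reward r Sstar]. *)
  by rewrite ler_pdivrMr // mul1r hR0 -(rewardC r Sstar) lerDr.
- apply: mixed_trap_in_box => [i|]; first by rewrite divr_ge0 // ltW.
  by rewrite -mulr_suml -hR0 divff.
- move=> q Bq; apply: expected_payoff_maximizer_pure Bq _ => H.
  rewrite inE => /cards1P[i ->]; rewrite hR0 choose_or_complement_payoff //.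
  by rewrite -hR0.
- move=> p Ap; apply: expected_payoff_minimizer_pure Ap _ => S _.
  rewrite trap_in_box_payoff ler_pM2r ?invr_gt0 //.
  exact: reward_prod_le.
Qed.
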